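(* Let $G$ be a finite directed graph such that the undirected graph $\nabla G$ contains a cycle. Then the stable composite state problem (''given a CFSM protocol $\mathbf P$ with communication graph $G$ and a composite state $S$ of $\mathbf P$, is $S$ stable?'') is algorithmically undecidable for CFSM protocols with communication graph $G$.
   Context: For a directed graph $G$, $\nabla G$ denotes the corresponding undirected (multi)graph obtained by forgetting edge orientations (parallel edges are kept, so e.g. two opposite edges between the same two nodes form a cycle). A CFSM protocol $\mathbf P$ with communication graph $G=(N,E)$ (each edge $\xi$ has tail $-\xi$ and head $+\xi$) consists of pairwise disjoint finite message sets $M_\xi$, $\xi\in E$, and for each $j\in N$ a finite state machine $F_j=(K_j,\Sigma_j,T_j,h_j)$ with finite state set $K_j$, initial state $h_j$, alphabet $\Sigma_j=\{+b: b\in M_\xi,\ j=+\xi\}\cup\{-b: b\in M_\xi,\ j=-\xi\}$ and transitions $T_j\subseteq K_j\times\Sigma_j\times K_j$ ($+b$ = receive, $-b$ = send). A composite state is $S=(p_j:j\in N)$, $p_j\in K_j$; a channel content is $C=(x_\xi:\xi\in E)$, $x_\xi\in M_\xi^*$; global states are pairs $(S,C)$; $C^0$ has all components empty and the initial global state is $((h_j:j\in N),C^0)$. A step: some machine $F_i$ takes a transition $p_i\xrightarrow{-b}q_i$ with $b\in M_\beta$, $i=-\beta$, and $b$ is appended to the end of $x_\beta$; or takes $p_i\xrightarrow{+b}q_i$ with $b\in M_\beta$, $i=+\beta$, where $x_\beta$ begins with $b$ and this first symbol is removed; all other machine states and channels are unchanged. A composite state $S$ is stable if the global state $(S,C^0)$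 is reachable from the initial global state by finitely many steps. *)

(* Defs.v *)
From Stdlib Require Import Relations.
From mathcomp Require Import all_boot.
Set Implicit Arguments. Unset Strict Implicit. Unset Printing Implicit Defensive.

Inductive recf : Type :=
| RZero : recf
| RSucc : recf
| RProj : nat -> recf                   (* i-th argument (0 if absent) *)
| RComp : recf -> list recf -> recf
| RPrec : recf -> recf -> recf
| RMu   : recf -> recf.

Inductive reval : recf -> seq nat -> nat -> Prop :=
| ev_zero xs : reval RZero xs 0
| ev_succ xs : reval RSucc xs (nth 0 xs 0).+1
| ev_proj i xs : reval (RProj i) xs (nth 0 xs i)
| ev_comp f gs xs ys y :
    revals gs xs ys -> reval f ys y -> reval (RComp f gs) xs y
| ev_prec0 f g xs y : reval f xs y -> reval (RPrec f g) (0 :: xs) y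
| ev_precS f g n xs r y :
    reval (RPrec f g) (n :: xs) r -> reval g (n :: r :: xs) y ->
    reval (RPrec f g) (n.+1 :: xs) y
| ev_mu f xs n :
    reval f (n :: xs) 0 ->
    (forall m, m < n -> exists k, reval f (m :: xs) k.+1) ->
    reval (RMu f) xs n
with revals : list recf -> seq nat -> seq nat -> Prop :=
| evs_nil xs : revals nil xs [::]
| evs_cons g gs xs y ys :
    reval g xs y -> revals gs xs ys -> revals (g :: gs) xs (y :: ys).

Definition decidable_on (X : countType) (valid P : X -> Prop) : Prop :=
  exists f : recf, forall x : X, valid x ->
    (P x -> reval f [:: pickle x] 1) /\ (~ P x -> reval f [:: pickle x] 0).

(* Graphs: a finite directed (multi)graph is given by finite types of  *)
(* nodes N and edges E, with tail and head maps.                       *)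

(* The undirected multigraph nabla G contains a cycle: pairwise distinct
   edges e_0..e_k and pairwise distinct nodes v_0..v_k such that e_i joins
   v_i and v_(i+1 mod k+1) (in either orientation). A loop is a cycle of
   length 1, two parallel (or opposite) edges form a cycle of length 2. *)
Definition undirected_has_cycle (N E : finType) (tl hd : E -> N) : Prop :=
  exists (k : nat) (es : 'I_k.+1 -> E) (vs : 'I_k.+1 -> N),
    injective es /\ injective vs /\
    forall i : 'I_k.+1,
      (tl (es i) = vs i /\ hd (es i) = vs (ordS i)) \/
      (hd (es i) = vs i /\ tl (es i) = vs (ordS i)).

(* Messages are natural numbers; the states of machine F_j are         *)
(* 0, ..., nstates j - 1.  A transition (p, snd, b, q) of F_j is        *)
(*   p --(-b)--> q if snd = true  (send b),                            *)
(*   p --(+b)--> q if snd = false (receive b).                         *)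
Section CFSM.
Variables (N E : finType) (tl hd : E -> N).

Definition protocol : Type :=
  ({ffun E -> seq nat}
   * {ffun N -> nat}
   * {ffun N -> nat}
   * {ffun N -> seq (nat * bool * nat * nat)})%type.

Definition msgs (P : protocol) : E -> seq nat := P.1.1.1.
Definition nstates (P : protocol) : N -> nat := P.1.1.2.
Definition init (P : protocol) : N -> nat := P.1.2.
Definition trans (P : protocol) : N -> seq (nat * bool * nat * nat) := P.2.

Definition composite_state : Type := {ffun N -> nat}.
Definition channels : Type := {ffun E -> seq nat}.

Definition wf_protocol (P : protocol) : Prop :=
  (forall xi zeta : E, xi != zeta ->
     forall b, b \in msgs P xi -> b \notin msgs P zeta) /\
  (forall j, init P j < nstates P j) /\
  (forall j p snd b q, (p, snd, b, q) \in trans P j ->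
     [/\ p < nstates P j, q < nstates P j &
         (exists xi : E, b \in msgs P xi /\
                        (if snd then tl xi = j else hd xi = j))]).

Definition is_composite_state (P : protocol) (St : composite_state) : Prop :=
  forall j, St j < nstates P j.

Definition step (P : protocol) (g g' : composite_state * channels) : Prop :=
  let: (St, C) := g in let: (St2, C') := g' in
  exists (j : N) (p : nat) (snd : bool) (b : nat) (q : nat) (xi : E),
    [/\ (p, snd, b, q) \in trans P j,
        St j = p /\ St2 j = q,
        (forall k, k != j -> St2 k = St k),
        b \in msgs P xi &
        (forall zeta, zeta != xi -> C' zeta = C zeta) /\
        (if snd then tl xi = j /\ C' xi = rcons (C xi) b
         else hd xi = j /\ C xi = b :: C' xi)].

Definition empty_channels : channels := [ffun _ => [::]].

Definition initial_global (P : protocol) : composite_state * channels :=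
  ([ffun j => init P j], empty_channels).

Definition stable (P : protocol) (St : composite_state) : Prop :=
  clos_refl_trans _ (step P) (initial_global P) (St, empty_channels).

End CFSM.

Definition scs_input (N E : finType) : countType :=
  (protocol N E * composite_state N)%type.

Definition scs_valid (N E : finType) (tl hd : E -> N)
  (x : scs_input N E) : Prop :=
  wf_protocol tl hd x.1 /\ is_composite_state x.1 x.2.

Definition scs_stable (N E : finType) (tl hd : E -> N)
  (x : scs_input N E) : Prop :=
  stable tl hd x.1 x.2.

(* Main.v *)
From Stdlib Require Import Relations.
Require Import Defs.
From mathcomp Require Import all_boot zify.
Set Implicit Arguments. Unset Strict Implicit. Unset Printing Implicit Defensive.

(** Suppose a recursive function [f] decides the problem. One node of the cycle,
    the controller, runs an automaton that uses the cycle as a queue of letters,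
    and the other nodes relay letters. Whatever the orientations, an edge of the
    cycle carries the same word as its neighbours, up to what is still in transit;
    hence reaching empty channels means that the word the controller produces on
    one side is the word it consumes on the other, as for a queue. If the
    controller is deterministic, such a run can only be the genuine queue
    computation, even when the orientations allow letters to be consumed early.

    Queue automata compute all recursive functions, on a queue of unary counters.
    The controller first loads a number [x] in unary; when [x] is the code of the
    remaining transition list, the code of the whole protocol is a recursive
    function [d] of [x]. Compiling "run [f] on [d x], accept iff the result is 0"
    to an automaton and loading the code of its own transition list yields a
    protocol that is stable iff [f] says that it is not. *)

(** * Computable functions *)

(* [A] is arbitrary: computability is relative to the encoding [input]. *)
Definition computable (A : Type) (X : countType) (k : nat)
    (input : A -> k.-tuple nat) (F : A -> X) : Prop :=
  exists f, forall a, reval f (input a) (pickle (F a)).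

Lemma revals_proj m n (s : seq nat) :
  size s = m + n -> revals [seq RProj i | i <- iota m n] s (drop m s).
Proof.
elim: n m => [|n IH] m sE; first by rewrite drop_oversize ?sE ?addn0 //; constructor.
rewrite (drop_nth 0) ?sE ?addnS ?leq_addr //.
by constructor; [constructor | apply: IH; rewrite sE addnS].
Qed.

Section Computable.
Variables (A : Type) (k : nat) (input : A -> k.-tuple nat).
Implicit Type X : countType.

Lemma eq_computable X (F G : A -> X) :
  F =1 G -> computable input F -> computable input G.
Proof. by move=> eFG [f fP]; exists f => a; rewrite -eFG. Qed.

Lemma computable_nth i : computable input (fun a => nth 0 (input a) i).
Proof. by exists (RProj i) => a; constructor. Qed.

Lemma computable_succ (F : A -> nat) :
  computable input F -> computable input (fun a => (F a).+1).
Proof.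
case=> f fP; exists (RComp RSucc [:: f]) => a.
by apply: (@ev_comp _ _ _ [:: F a]); [constructor; [exact: fP | constructor] | constructor].
Qed.

Lemma computable_const X (x : X) : computable input (fun=> x).
Proof.
rewrite /computable; elim: (pickle x) => [|n]; last exact: (@computable_succ (fun=> n)).
by exists RZero => a; constructor.
Qed.

Lemma computable_drop X (B : Type) (g : B -> A) m (input' : B -> (m + k).-tuple nat)
    (F : A -> X) :
  (forall b, drop m (input' b) = input (g b)) ->
  computable input F -> computable input' (F \o g).
Proof.
move=> dropE [f fP]; exists (RComp f [seq RProj i | i <- iota m k]) => b.
by apply: ev_comp (fP (g b)); rewrite -dropE; apply: revals_proj; rewrite size_tuple.
Qed.

Definition rec_input X (t : nat * X * A) : k.+2.-tuple nat :=
  [tuple of t.1.1 :: pickle t.1.2 :: input t.2].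

Lemma computable_rec X (F : A -> X) (G : nat -> X -> A -> X) (H : A -> nat) :
  computable input F ->
  computable (@rec_input X) (fun t => G t.1.1 t.1.2 t.2) ->
  computable input H ->
  computable input (fun a => nat_rect (fun=> X) (F a) (fun n x => G n x a) (H a)).
Proof.
case=> [f fP] [g gP] [h hP].
exists (RComp (RPrec f g) (h :: [seq RProj i | i <- iota 0 k])) => a.
apply: (ev_comp (ys := H a :: input a)).
  constructor; first exact: hP.
  by rewrite -{2}(drop0 (input a)); apply: revals_proj; rewrite size_tuple.
elim: (H a) => [|n IH] /=; first by constructor; apply: fP.
by apply: ev_precS IH _; apply: (gP (n, _, a)).
Qed.

End Computable.

Lemma computable_rec_input (A : Type) k (input : A -> k.-tuple nat)
    (X Y : countType) (F : A -> Y) :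
  computable input F -> computable (@rec_input _ _ input X) (fun t => F t.2).
Proof. by apply: (computable_drop (m := 2)) => -[[n x] a] /=; rewrite drop0. Qed.

Lemma computable_add (A : Type) k (input : A -> k.-tuple nat) (F G : A -> nat) :
  computable input F -> computable input G -> computable input (fun a => F a + G a).
Proof.
move=> cF cG; have := computable_rec (G := fun _ r _ => r.+1) cF
  (computable_succ (computable_nth _ 1)) cG.
by apply: eq_computable => a; elim: (G a) => [|n /= ->]; rewrite ?addn0 ?addnS.
Qed.

Lemma computable_mul (A : Type) k (input : A -> k.-tuple nat) (F G : A -> nat) :
  computable input F -> computable input G -> computable input (fun a => F a * G a).
Proof.
move=> cF cG; have := computable_rec (G := fun _ r a => F a + r) (computable_const _ 0)
  (computable_add (computable_rec_input _ cF) (computable_nth _ 1)) cG.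
by apply: eq_computable => a; elim: (G a) => [|n /= ->]; rewrite ?muln0 ?mulnS.
Qed.

Lemma computable_exp2 (A : Type) k (input : A -> k.-tuple nat) (F : A -> nat) :
  computable input F -> computable input (fun a => 2 ^ F a).
Proof.
move=> cF; have := computable_rec (G := fun _ r _ => r + r) (computable_const _ 1)
  (computable_add (computable_nth _ 1) (computable_nth _ 1)) cF.
by apply: eq_computable => a; elim: (F a) => [|n /= ->] //; rewrite expnS mul2n addnn.
Qed.

Section ComputableData.
Variables (A : Type) (k : nat) (input : A -> k.-tuple nat).
Implicit Types X Y : countType.

Lemma computable_cons X (F : A -> X) (G : A -> seq X) :
  computable input F -> computable input G -> computable input (fun a => F a :: G a).
Proof.
move=> cF cG; have := computable_mul (computable_exp2 cF)
  (computable_succ (computable_add cG cG)).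
by case=> f fP; exists f => a; have := fP a; rewrite addnn.
Qed.

Lemma computable_pair X Y (F : A -> X) (G : A -> Y) :
  computable input F -> computable input G -> computable input (fun a => (F a, G a)).
Proof.
move=> cF cG; have [f fP] : computable input (fun a => [:: pickle (F a); pickle (G a)]).
  by do 2![apply: computable_cons => //]; apply: computable_const.
by exists f.
Qed.

Lemma computable_map (T : Type) X (s : seq T) (F : T -> A -> X) :
  (forall t, computable input (F t)) -> computable input (fun a => [seq F t a | t <- s]).
Proof.
move=> cF; elim: s => [|t s IH] /=; first exact: computable_const.
exact: computable_cons.
Qed.

Lemma pickle_ffun (T : finType) X (f : {ffun T -> X}) :
  pickle f = pickle [seq (t, f t) | t <- enum T].
Proof.
transitivity (pickle (val (tfgraph f))); first by rewrite {1}/pickle; unlock.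
rewrite /= /codom /image_mem; congr CodeSeq.code.
by rewrite -!map_comp; apply: eq_map.
Qed.

Lemma computable_ffun (T : finType) X (F : T -> A -> X) :
  (forall t, computable input (F t)) -> computable input (fun a => [ffun t => F t a]).
Proof.
move=> cF; have [f fP] : computable input (fun a => [seq (t, F t a) | t <- enum T]).
  by apply: computable_map => t; apply: computable_pair; first exact: computable_const.
by exists f => a; rewrite pickle_ffun; under eq_map => t do rewrite ffunE; exact: fP.
Qed.

End ComputableData.

Lemma ltn_pickle_pair (X Y : countType) (x : X) (y : Y) :
  pickle x < pickle (x, y) /\ pickle y < pickle (x, y).
Proof. by have /= /and3P[] := CodeSeq.ltn_code [:: pickle x; pickle y]. Qed.

Lemma ltn_pickle_mem (X : countType) (x : X) (s : seq X) :
  x \in s -> pickle x < pickle s.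
Proof. by move=> /(map_f pickle); apply: (allP (CodeSeq.ltn_code _)). Qed.

(** * Loop programs *)

Inductive prog :=
| Skip
| Inc of nat
| Seq of prog & prog
| Loop of nat & prog.

Definition store := nat -> nat.

Definition upd (s : store) (i n : nat) : store := fun j => if j == i then n else s j.

Inductive while (i : nat) (R : store -> store -> Prop) : store -> store -> Prop :=
| while_stop s : s i = 0 -> while i R s s
| while_next s s1 s2 :
    0 < s i -> R (upd s i (s i).-1) s1 -> while i R s1 s2 -> while i R s s2.

Fixpoint exec (P : prog) (s s' : store) : Prop :=
  match P with
  | Skip => s' = s
  | Inc i => s' = upd s i (s i).+1
  | Seq P Q => exists2 s1, exec P s s1 & exec Q s1 s'
  | Loop i P => while i (exec P) s s'
  end.

Definition terminates (P : prog) (s : store) (Q : store -> Prop) : Prop :=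
  exists2 s', exec P s s' & Q s'.

Lemma terminates_weaken P s (Q Q' : store -> Prop) :
  terminates P s Q -> (forall s', Q s' -> Q' s') -> terminates P s Q'.
Proof. by case=> s' xP Qs' QQ'; exists s'; last exact: QQ'. Qed.

Lemma terminates_skip s (Q : store -> Prop) : Q s -> terminates Skip s Q.
Proof. by exists s. Qed.

Lemma terminates_inc i s (Q : store -> Prop) :
  Q (upd s i (s i).+1) -> terminates (Inc i) s Q.
Proof. by exists (upd s i (s i).+1). Qed.

Lemma terminates_seq P P' s (Q : store -> Prop) :
  terminates P s (fun s' => terminates P' s' Q) -> terminates (Seq P P') s Q.
Proof. by case=> sP xP [sP' xP' QsP']; exists sP' => //; exists sP. Qed.

Lemma terminates_loop (I : store -> Prop) (m : store -> nat) i P s :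
  (forall s, I s -> 0 < s i ->
     terminates P (upd s i (s i).-1) (fun s' => I s' /\ m s' < m s)) ->
  I s -> terminates (Loop i P) s (fun s' => I s' /\ s' i = 0).
Proof.
move=> body; have [n] := ubnP (m s); elim: n s => // n IH s ltn Is.
case: (posnP (s i)) => [si0|si_gt0]; first by exists s => //; apply: while_stop.
have [sP xP [IsP ltm]] := body s Is si_gt0.
have [sL xL QsL] := IH sP (leq_trans ltm ltn) IsP.
by exists sL; first exact: while_next xP xL.
Qed.

Ltac upd_cases := rewrite /upd; repeat (case: eqP => ?); subst => //=; try lia.

Definition clear (a : nat) : prog := Loop a Skip.

Definition transfer (a b : nat) : prog := Seq (clear b) (Loop a (Inc b)).

Definition copy (a b t : nat) : prog :=
  Seq (Seq (clear b) (clear t)) (Seq (Loop a (Seq (Inc b) (Inc t))) (transfer t a)).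

Lemma terminates_clear a s : terminates (clear a) s (fun s' => s' =1 upd s a 0).
Proof.
apply: terminates_weaken (terminates_loop (m := fun s' => s' a)
  (I := fun s' => forall j, j != a -> s' j = s j) _ _) _ => //.
- move=> t tE t_gt0; apply: terminates_skip; split; last by upd_cases.
  by move=> j nja; rewrite -tE //; upd_cases.
- by move=> s' [s'E s'a] j; rewrite /upd; case: eqP => [->|/eqP/s'E].
Qed.

Lemma terminates_transfer a b s :
  a != b -> terminates (transfer a b) s (fun s' => s' =1 upd (upd s b (s a)) a 0).
Proof.
move=> nab; apply: terminates_seq.
apply: terminates_weaken (terminates_clear b s) _ => sb sbE.
apply: terminates_weaken (terminates_loop (m := fun s' => s' a) (I := fun s' =>
  s' a + s' b = s a /\ forall j, j != a -> j != b -> s' j = s j) _ _) _.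
- move=> t [sum tE] t_gt0; apply: terminates_inc; split; last by upd_cases.
  by split=> [|j nja njb]; [|rewrite -tE //]; upd_cases.
- by split=> [|j nja njb]; rewrite !sbE; upd_cases.
- by move=> s' [[sum s'E] s'a] j; upd_cases; apply: s'E; apply/eqP.
Qed.

Lemma terminates_copy a b t s : a != b -> a != t -> b != t ->
  terminates (copy a b t) s (fun s' => s' =1 upd (upd s b (s a)) t 0).
Proof.
move=> nab nat nbt; apply/terminates_seq/terminates_seq.
apply: terminates_weaken (terminates_clear b s) _ => sb sbE.
apply: terminates_weaken (terminates_clear t sb) _ => st stE.
apply: terminates_seq; apply: terminates_weaken (terminates_loop (m := fun s' => s' a)
  (I := fun s' => [/\ s' a + s' b = s a, s' t = s' b &
                   forall j, j != a -> j != b -> j != t -> s' j = s j]) _ _) _.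
- move=> u [sum utb uE] ua; apply/terminates_seq/terminates_inc/terminates_inc.
  by split; [split=> [||j nja njb njt]; [| |rewrite -uE //]|]; upd_cases.
- by split=> [||j nja njb njt]; rewrite !stE /upd !sbE; upd_cases.
- move=> u [[sum utb uE] ua]; have nta : t != a by rewrite eq_sym.
  apply: terminates_weaken (terminates_transfer u nta) _ => s' s'E j; rewrite s'E.
  by upd_cases; apply: uE; apply/eqP.
Qed.

Definition fetch (ins : seq nat) (out n i : nat) : prog :=
  if i < size ins then copy (nth 0 ins i) out n else clear out.

Definition for_each (T : Type) (P : T -> nat -> prog) (xs : seq T) (i : nat) : prog :=
  foldr (fun x Q j => Seq (P x j) (Q j.+1)) (fun=> Skip) xs i.

(* The registers [ins] hold the arguments, [out] receives the result, and the
   registers from [n] on are free for intermediate results. *)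
Fixpoint compile (f : recf) (ins : seq nat) (out n : nat) : prog :=
  match f with
  | RZero => clear out
  | RSucc => Seq (fetch ins out n 0) (Inc out)
  | RProj i => fetch ins out n i
  | RComp f gs =>
      let n' := n + size gs in
      Seq (for_each (fun g i => compile g ins i n') gs n)
          (compile f (iota n (size gs)) out n')
  | RPrec f g =>
      if ins is a :: ins' then
        Seq (Seq (compile f ins' n.+2 n.+4) (Seq (copy a n n.+3) (clear n.+1)))
            (Seq (Loop n (Seq (compile g [:: n.+1, n.+2 & ins'] n.+3 n.+4)
                              (Seq (transfer n.+3 n.+2) (Inc n.+1))))
                 (transfer n.+2 out))
      else Skip
  | RMu f =>
      Seq (Seq (clear n) (compile f (n :: ins) n.+1 n.+2))
          (Seq (Loop n.+1 (Seq (Inc n) (compile f (n :: ins) n.+1 n.+2)))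
               (transfer n out))
  end.

Definition writes (out n y : nat) (s s' : store) : Prop :=
  s' out = y /\ forall i, i < n -> i != out -> s' i = s i.

Definition allocated (ins : seq nat) (out n : nat) : Prop :=
  [/\ {in ins, forall i, i < n}, out < n & out \notin ins].

Definition compiles (f : recf) : Prop := forall xs y s ins out n,
  reval f xs y -> xs = [seq s i | i <- ins] ->
  allocated ins out n ->
  terminates (compile f ins out n) s (writes out n y s).

Lemma terminates_fetch s ins out n i :
  allocated ins out n ->
  terminates (fetch ins out n i) s (writes out n (nth 0 [seq s j | j <- ins] i) s).
Proof.
case=> insn lto nin; rewrite /fetch; case: ltnP => [lti|lei]; last first.
  apply: terminates_weaken (terminates_clear out s) _ => s' s'E.
  rewrite nth_default ?size_map //; split=> [|j _ /negPf nj]; rewrite s'E /upd ?eqxx //.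
  by rewrite nj.
have ini := mem_nth 0 lti; have ltin := insn _ ini.
apply: terminates_weaken (terminates_copy s _ _ _) _ => [|||s' s'E].
- by apply: contra nin => /eqP <-.
- by rewrite ltn_eqF.
- by rewrite ltn_eqF.
split=> [|j ltj /negPf nj]; rewrite s'E /upd ltn_eqF //; last by rewrite nj.
by rewrite eqxx (nth_map 0).
Qed.

Lemma compiles_zero : compiles RZero.
Proof.
move=> xs y s ins out n ev _ _; inversion ev; subst.
apply: terminates_weaken (terminates_clear out s) _ => s' s'E.
by split=> [|i _ /negPf ni]; rewrite s'E /upd ?eqxx ?ni.
Qed.

Lemma compiles_succ : compiles RSucc.
Proof.
move=> xs y s ins out n ev xsE free; inversion ev; subst.
apply/terminates_seq/(terminates_weaken (terminates_fetch s 0 free)) => s' [s'out s'E].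
apply: terminates_inc; split=> [|i lti ni]; rewrite /upd ?eqxx ?s'out //.
by rewrite (negPf ni) s'E.
Qed.

Lemma compiles_proj i : compiles (RProj i).
Proof.
by move=> xs y s ins out n ev xsE free; inversion ev; subst; apply: terminates_fetch.
Qed.

Lemma terminates_compile_args gs s ins n n' xs ys :
  List.Forall compiles gs -> revals gs xs ys -> xs = [seq s i | i <- ins] ->
  {in ins, forall i, i < n} -> n + size gs <= n' ->
  terminates (for_each (fun g i => compile g ins i n') gs n) s (fun s' =>
    [seq s' i | i <- iota n (size gs)] = ys /\ forall i, i < n -> s' i = s i).
Proof.
elim: gs s n ys => [|g gs IH] s n ys cgs evs xsE insn /= len'.
  by apply: terminates_skip; inversion evs.
inversion cgs as [|? ? cg cgs']; inversion evs as [|? ? ? y ys' evg evgs]; subst.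
have free : allocated ins n n'.
  by split=> [i /insn||]; [lia | lia | apply/negP => /insn; rewrite ltnn].
apply/terminates_seq/(terminates_weaken (cg _ _ _ _ _ _ evg (erefl _) free)).
move=> sg [sgn sgE]; have {}sgE i : i < n -> sg i = s i by move=> lti; apply: sgE; lia.
apply: terminates_weaken (IH sg n.+1 ys' _ _ _ _ _) _ => //.
- by apply/eq_in_map => i /insn /sgE.
- by move=> i /insn; apply: ltnW.
- by lia.
- by move=> s' [ysE s'E]; split=> [|i lti]; rewrite ?s'E ?ysE ?sgn ?sgE //; lia.
Qed.

Lemma compiles_comp f gs :
  compiles f -> List.Forall compiles gs -> compiles (RComp f gs).
Proof.
move=> cf cgs xs y s ins out n ev xsE [insn lto _].
inversion ev as [| | |? ? ? ys ? evs evf| | |]; subst.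
apply: terminates_seq.
apply: terminates_weaken (terminates_compile_args cgs evs _ insn (leqnn _)) _ => //.
move=> sargs [ysE sargsE].
apply: terminates_weaken (cf _ _ _ _ out _ evf (esym ysE) _) _.
  by split=> [i||]; rewrite ?mem_iota; lia.
by move=> s' [s'out s'E]; split=> // i lti ni; rewrite s'E ?sargsE ?ltn_addr.
Qed.

Lemma reval_prec_trace f g m xs y : reval (RPrec f g) (m :: xs) y ->
  exists r : nat -> nat, [/\ reval f xs (r 0),
    forall i, i < m -> reval g [:: i, r i & xs] (r i.+1) & r m = y].
Proof.
elim: m y => [|m IH] y ev; inversion ev as [| | | | |? ? ? ? ym ? evm evg|]; subst.
  by exists (fun=> y).
have [r [f_r g_r rm]] := IH _ evm.
exists (upd r m.+1 y); split; [by upd_cases | | by rewrite /upd eqxx].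
move=> i; rewrite ltnS leq_eqVlt => /predU1P[->|lti].
  by rewrite /upd eqxx ltn_eqF // rm.
by rewrite /upd !ltn_eqF ?ltnS //; [apply: g_r | apply: ltnW].
Qed.

Section CompilePrec.
Variables (g : recf) (ins : seq nat) (n m : nat) (r : nat -> nat) (s_init : store).
Hypotheses (cg : compiles g) (insn : {in ins, forall i, i < n}).
Hypothesis gr : forall i, i < m -> reval g [:: i, r i & [seq s_init j | j <- ins]] (r i.+1).

(* Register [n] counts down, [n.+1] counts up, and [n.+2] accumulates. *)
Definition prec_invariant (s : store) : Prop :=
  [/\ s n + s n.+1 = m, s n.+2 = r (s n.+1) & forall i, i < n -> s i = s_init i].

Lemma terminates_prec_body s : prec_invariant s -> 0 < s n ->
  terminates (Seq (compile g [:: n.+1, n.+2 & ins] n.+3 n.+4)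
                  (Seq (transfer n.+3 n.+2) (Inc n.+1)))
             (upd s n (s n).-1) (fun s' => prec_invariant s' /\ s' n < s n).
Proof.
case=> sum acc same s_gt0; have free : allocated [:: n.+1, n.+2 & ins] n.+3 n.+4.
  split=> // [i|]; rewrite !inE; first by case/or3P=> [/eqP->|/eqP->|/insn]; lia.
  by apply/or3P=> -[/eqP|/eqP|/insn]; lia.
have lt_m : s n.+1 < m by lia.
apply: terminates_seq; apply: terminates_weaken (cg (gr lt_m) _ free) _.
  rewrite /= -acc; congr [:: _, _ & _]; try by upd_cases.
  by apply/eq_in_map => i /insn lti; rewrite -same //; upd_cases.
move=> sg [sg_out sgE]; apply: terminates_seq.
apply: terminates_weaken (terminates_transfer sg _) _; first by lia.
move=> st stE.
have st_count : st n = (s n).-1 by rewrite stE; upd_cases; rewrite sgE; upd_cases.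
have st_index : st n.+1 = s n.+1 by rewrite stE; upd_cases; rewrite sgE; upd_cases.
have st_acc : st n.+2 = r (s n.+1).+1 by rewrite stE -sg_out; upd_cases.
have st_low i : i < n -> st i = s_init i.
  by move=> lti; rewrite -same // stE; upd_cases; rewrite sgE; upd_cases.
apply: terminates_inc; rewrite /prec_invariant.
split; [split=> [||i lti] | by upd_cases]; first by upd_cases.
- by upd_cases; rewrite st_index.
- by rewrite -st_low //; upd_cases.
Qed.

End CompilePrec.

Lemma compiles_prec f g : compiles f -> compiles g -> compiles (RPrec f g).
Proof.
move=> cf cg xs y s [|a ins] out n ev xsE [insn lto nin]; first by subst; inversion ev.
rewrite {}xsE /= in ev; have [r [fr gr ry]] := reval_prec_trace ev.
have ltan : a < n by apply: insn; rewrite mem_head.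
have {}insn : {in ins, forall i, i < n}.
  by move=> i ini; apply: insn; rewrite inE ini orbT.
apply/terminates_seq/terminates_seq.
apply: terminates_weaken (cf _ _ s ins n.+2 n.+4 fr (erefl _) _) _.
  by split=> // [i /insn|]; [lia | apply/negP => /insn; lia].
move=> sbase [sbase_acc sbaseE]; apply/terminates_seq.
apply: terminates_weaken (terminates_copy sbase _ _ _) _; [lia..|] => scopy scopyE.
apply: terminates_weaken (terminates_clear n.+1 scopy) _ => sinit sinitE.
apply: terminates_seq.
apply: terminates_weaken (terminates_loop (terminates_prec_body cg insn gr) _) _.
  by split=> [||i lti]; rewrite !sinitE /upd !scopyE; upd_cases;
    rewrite ?sbase_acc ?sbaseE //; lia.
move=> sloop [[sum acc same] sloop_count].
apply: terminates_weaken (terminates_transfer sloop _) _; first by lia.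
have sloop_acc : sloop n.+2 = y by rewrite acc -ry -sum sloop_count.
by move=> s' s'E; split=> [|i lti ni]; rewrite s'E -?same //; upd_cases.
Qed.

Lemma reval_mu_zero_iff f xs y : reval (RMu f) xs y ->
  forall i, i <= y -> exists2 z, reval f (i :: xs) z & (z == 0) = (i == y).
Proof.
move=> ev i lei; inversion ev as [| | | | | |? ? ? f0 fS]; subst.
have [->|ni] := eqVneq i y; first by exists 0.
by have [|z fz] := fS i _; [lia | exists z.+1].
Qed.

Section CompileMu.
Variables (f : recf) (ins : seq nat) (n y : nat) (s_init : store).
Hypotheses (cf : compiles f) (insn : {in ins, forall i, i < n}).
Hypothesis mu_y : reval (RMu f) [seq s_init i | i <- ins] y.

Definition mu_invariant (s : store) : Prop :=
  [/\ s n <= y, (s n.+1 == 0) = (s n == y) & forall i, i < n -> s i = s_init i].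

Lemma terminates_mu_test s : s n <= y -> (forall i, i < n -> s i = s_init i) ->
  terminates (compile f (n :: ins) n.+1 n.+2) s
    (fun s' => mu_invariant s' /\ s' n = s n).
Proof.
move=> ley same; have [z fz zE] := reval_mu_zero_iff mu_y ley.
apply: terminates_weaken (cf (s := s) (ins := n :: ins) (out := n.+1) (n := n.+2) fz _ _) _.
- by congr cons; apply/eq_in_map => i /insn /same.
- split=> // [i|]; rewrite !inE; first by case/predU1P=> [->|/insn]; lia.
  by apply/orP=> -[/eqP|/insn]; lia.
move=> s' [s'out s'E]; have s'n : s' n = s n by apply: s'E; lia.
rewrite /mu_invariant s'n s'out; split=> //; split=> // i lti.
by rewrite s'E ?same //; lia.
Qed.

Lemma terminates_mu_body s : mu_invariant s -> 0 < s n.+1 ->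
  terminates (Seq (Inc n) (compile f (n :: ins) n.+1 n.+2)) (upd s n.+1 (s n.+1).-1)
    (fun s' => mu_invariant s' /\ y - s' n < y - s n).
Proof.
case=> ley test same s_gt0; have lty : s n < y by lia.
apply/terminates_seq/terminates_inc.
apply: terminates_weaken (terminates_mu_test _ _) _ => [|i lti|s' [inv s'n]].
- by upd_cases.
- by rewrite -same //; upd_cases.
by split=> //; rewrite s'n; upd_cases.
Qed.

End CompileMu.

Lemma compiles_mu f : compiles f -> compiles (RMu f).
Proof.
move=> cf xs y s ins out n ev xsE [insn lto nin]; subst xs.
apply/terminates_seq/terminates_seq.
apply: terminates_weaken (terminates_clear n s) _ => sclear sclearE.
apply: terminates_weaken (terminates_mu_test cf insn ev _ _) _ => [|i lti|stest [inv _]].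
- by rewrite sclearE /upd eqxx.
- by rewrite sclearE /upd ltn_eqF.
apply: terminates_seq.
apply: terminates_weaken (terminates_loop (terminates_mu_body cf insn ev) inv) _.
move=> sloop [[_ test same] sloop_value].
have sloop_index : sloop n = y by apply/eqP; rewrite -test sloop_value.
apply: terminates_weaken (terminates_transfer sloop _) _; first by lia.
by move=> s' s'E; split=> [|i lti ni]; rewrite s'E -?same //; upd_cases.
Qed.

Lemma recf_nested_ind (P : recf -> Prop) :
  P RZero -> P RSucc -> (forall i, P (RProj i)) ->
  (forall f gs, P f -> List.Forall P gs -> P (RComp f gs)) ->
  (forall f g, P f -> P g -> P (RPrec f g)) ->
  (forall f, P f -> P (RMu f)) -> forall f, P f.
Proof.
move=> Pzero Psucc Pproj Pcomp Pprec Pmu; fix IH 1 => -[||i|f gs|f g|f].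
- exact: Pzero.
- exact: Psucc.
- exact: Pproj.
- by apply: Pcomp => //; elim: gs => [|g gs IHgs]; constructor.
- by apply: Pprec; apply: IH.
- by apply: Pmu; apply: IH.
Qed.

Lemma compile_correct f : compiles f.
Proof.
elim/recf_nested_ind: f => [||i|f gs|f g|f].
- exact: compiles_zero.
- exact: compiles_succ.
- exact: compiles_proj.
- exact: compiles_comp.
- exact: compiles_prec.
- exact: compiles_mu.
Qed.

(** * Rotating programs *)

(* Programs on a list of registers that only see the front one. [RLoop] moves
   the tested register to the back only when it finds it zero, since a queue
   cannot be inspected without dequeuing. *)
Inductive rprog :=
| Rot
| IncRot
| RSeq of rprog & rprog
| RLoop of rprog.

Inductive rexec : rprog -> seq nat -> seq nat -> Prop :=
| rexec_rot n c : rexec Rot (n :: c) (rcons c n)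
| rexec_inc n c : rexec IncRot (n :: c) (rcons c n.+1)
| rexec_seq P Q c c1 c2 : rexec P c c1 -> rexec Q c1 c2 -> rexec (RSeq P Q) c c2
| rexec_stop P c : rexec (RLoop P) (0 :: c) (rcons c 0)
| rexec_next P n c c1 c2 :
    rexec P (n :: c) c1 -> rexec (RLoop P) c1 c2 -> rexec (RLoop P) (n.+1 :: c) c2.

Definition rot_before (n : nat) (P : rprog) : rprog := iter n (RSeq Rot) P.

Definition rot_after (n : nat) (P : rprog) : rprog :=
  iter n (fun Q => RSeq Q Rot) P.

Lemma rexec_rot1 c : 0 < size c -> rexec Rot c (rot 1 c).
Proof. by case: c => // n c _; rewrite rot1_cons; apply: rexec_rot. Qed.

Lemma rexec_rot_before n P c c' :
  n <= size c -> rexec P (rot n c) c' -> rexec (rot_before n P) c c'.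
Proof.
elim: n c => [|n IH] c len /=; first by rewrite rot0.
rewrite -addn1 rotD ?addn1 // => xP; apply: rexec_seq (rexec_rot1 _) _.
  exact: leq_trans len.
by apply: IH; rewrite // size_rot ltnW.
Qed.

Lemma rexec_rot_after n P c c' :
  n <= size c' -> rexec P c c' -> rexec (rot_after n P) c (rot n c').
Proof.
elim: n => [|n IH] len xP /=; first by rewrite rot0.
apply: rexec_seq (IH (ltnW len) xP) _; rewrite -add1n rotD ?add1n //.
by apply: rexec_rot1; rewrite size_rot; apply: leq_trans len.
Qed.

Fixpoint registers (P : prog) : nat :=
  match P with
  | Skip => 1
  | Inc i => i.+1
  | Seq P Q => maxn (registers P) (registers Q)
  | Loop i P => maxn i.+1 (registers P)
  end.

Section Rotating.
Variable r : nat.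

(* [Q] is meant to move register [i] from the front to the back. *)
Definition at_register (i : nat) (Q : rprog) : rprog :=
  rot_before i (rot_after (r - i.+1) Q).

Definition loop_body (i : nat) (Q : rprog) : rprog := rot_before (r - i) (rot_after i Q).

Fixpoint rotating (P : prog) : rprog :=
  match P with
  | Skip => at_register 0 Rot
  | Inc i => at_register i IncRot
  | Seq P Q => RSeq (rotating P) (rotating Q)
  | Loop i P => at_register i (RLoop (loop_body i (rotating P)))
  end.

Lemma rexec_at_register i Q s s' : i < r ->
  rexec Q (rot i (mkseq s r)) (rot 1 (rot i (mkseq s' r))) ->
  rexec (at_register i Q) (mkseq s r) (mkseq s' r).
Proof.
move=> ltir xQ; apply: rexec_rot_before; first by rewrite size_mkseq ltnW.
have <- : rot (r - i.+1) (rot 1 (rot i (mkseq s' r))) = mkseq s' r.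
  rewrite -!rotD ?size_rot ?size_mkseq; [|lia..].
  by rewrite addn1 subnSK // subnK ?(ltnW ltir) // rot_oversize ?size_mkseq.
by apply: rexec_rot_after => //; rewrite !size_rot size_mkseq; lia.
Qed.

Definition others (i : nat) (s : store) : seq nat :=
  [seq s j | j <- iota i.+1 (r - i.+1)] ++ [seq s j | j <- iota 0 i].

Lemma rot_mkseq i s : i < r -> rot i (mkseq s r) = s i :: others i s.
Proof.
move=> ltir; rewrite /rot /mkseq -map_drop -map_take drop_iota take_iota.
by rewrite (minn_idPl (ltnW ltir)) add0n -subnSK.
Qed.

Lemma rot_mkseq_upd i n s : i < r -> rot i (mkseq (upd s i n) r) = n :: others i s.
Proof.
move=> ltir; rewrite rot_mkseq // /upd eqxx /others.
congr (_ :: (_ ++ _)); apply/eq_in_map => j; rewrite mem_iota => j_range;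
  by rewrite ifN //; lia.
Qed.

Lemma rexec_loop i P s s' :
  (forall s s', exec P s s' -> rexec (rotating P) (mkseq s r) (mkseq s' r)) ->
  i < r -> exec (Loop i P) s s' ->
  rexec (RLoop (loop_body i (rotating P)))
        (rot i (mkseq s r)) (rot 1 (rot i (mkseq s' r))).
Proof.
move=> xP ltir; elim=> {s s'} [s si0|s t t' s_gt0 xbody _ xloop].
  by rewrite rot_mkseq // si0 rot1_cons; apply: rexec_stop.
rewrite rot_mkseq // -(prednK s_gt0); apply: rexec_next xloop.
rewrite -(rot_mkseq_upd _ s ltir); apply: rexec_rot_before.
  by rewrite size_rot size_mkseq leq_subr.
rewrite -rotD; last by rewrite size_mkseq subnK ?(ltnW ltir).
rewrite subnK ?(ltnW ltir) // rot_oversize ?size_mkseq //.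
by apply: rexec_rot_after; [rewrite size_mkseq ltnW | apply: xP].
Qed.

Lemma rexec_rotating P s s' : registers P <= r -> exec P s s' ->
  rexec (rotating P) (mkseq s r) (mkseq s' r).
Proof.
elim: P s s' => [|i|P IHP Q IHQ|i P IHP] s s' /=.
- move=> r_gt0 ->; apply: rexec_at_register => //; apply: rexec_rot1.
  by rewrite size_rot size_mkseq.
- move=> ltir ->; apply: rexec_at_register => //.
  by rewrite rot_mkseq_upd // rot_mkseq // rot1_cons; apply: rexec_inc.
- by rewrite geq_max => /andP[leP leQ] [t /IHP xP /IHQ xQ]; apply: rexec_seq (xP _) (xQ _).
- rewrite geq_max => /andP[ltir leP] xloop; apply: rexec_at_register => //.
  by apply: rexec_loop => // t t'; apply: IHP.
Qed.

End Rotating.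

Definition unary_program (f : recf) : prog := compile f [:: 0] 1 2.

Definition workspace (f : recf) : nat := (registers (unary_program f)).+1.

(* The last rotation brings register 1, which holds the result, to the front. *)
Definition rotating_recf (f : recf) : rprog :=
  RSeq (rotating (workspace f).+1 (unary_program f)) Rot.

Lemma rexec_rotating_recf f x y : reval f [:: x] y ->
  exists c, rexec (rotating_recf f) (x :: nseq (workspace f) 0) (y :: c).
Proof.
move=> fxy; set c := x :: _; pose s := nth 0 c.
have free : allocated [:: 0] 1 2 by split=> // i; rewrite inE => /eqP->.
have [s' xP [s'y _]] := @compile_correct f _ _ s [:: 0] _ _ fxy (erefl _) free.
have lt_out : 1 < (workspace f).+1 by [].
exists (others (workspace f).+1 1 s'); apply: rexec_seq; last first.
  by rewrite -s'y -rot_mkseq //; apply: rexec_rot1; rewrite size_mkseq.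
have <- : mkseq s (workspace f).+1 = c by rewrite -[RHS](mkseq_nth 0) /= size_nseq.
by apply: rexec_rotating _ xP; apply: leqW (leqnSn _).
Qed.

(** * Queue automata *)

(* A transition [(p, w, b, q)] goes from [p] to [q] by writing the letter [b] at
   the back of the queue if [w], and by reading it at the front otherwise. *)
Definition queue_trans : Type := (nat * bool * bool * nat)%type.

Inductive qstep (A : seq queue_trans) : nat * seq bool -> nat * seq bool -> Prop :=
| qstep_write p b q x : (p, true, b, q) \in A -> qstep A (p, x) (q, rcons x b)
| qstep_read p b q x : (p, false, b, q) \in A -> qstep A (p, b :: x) (q, x).

Notation qsteps A := (clos_refl_trans _ (qstep A)).

Lemma qsteps_write A p b q x x' :
  (p, true, b, q) \in A -> x' = rcons x b -> qsteps A (p, x) (q, x').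
Proof. by move=> Ap ->; apply: rt_step; apply: qstep_write. Qed.

Lemma qsteps_read A p b q x : (p, false, b, q) \in A -> qsteps A (p, b :: x) (q, x).
Proof. by move=> Ap; apply: rt_step; apply: qstep_read. Qed.

Lemma qsteps_subset A A' g h : {subset A <= A'} -> qsteps A g h -> qsteps A' g h.
Proof.
move=> subA; elim=> {g h} [g h [p b q x Ap|p b q x Ap]|g|g1 g2 g3 _ IH1 _ IH2].
- by apply: qsteps_write (subA _ Ap) _.
- exact: qsteps_read (subA _ Ap).
- exact: rt_refl.
- exact: rt_trans IH1 IH2.
Qed.

Lemma qsteps_absorbing A f x g :
  (forall w b q, (f, w, b, q) \in A -> q = f) -> qsteps A (f, x) g -> g.1 = f.
Proof.
move=> absorb /(clos_rt_rtn1 _ _ _ _); elim=> // g1 g2 st _.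
by case: st => p b q y Ap /= pf; subst p; apply: absorb Ap.
Qed.

Inductive qpath (A : seq queue_trans) : nat -> seq (bool * bool) -> nat -> Prop :=
| qpath_nil p : qpath A p [::] p
| qpath_cons p w b q l f :
    (p, w, b, q) \in A -> qpath A q l f -> qpath A p ((w, b) :: l) f.

Lemma qpath_rcons A p l q w b q' :
  qpath A p l q -> (q, w, b, q') \in A -> qpath A p (rcons l (w, b)) q'.
Proof.
elim=> {p l q} [p|p w' b' p' l q Ap _ IH] Aq /=.
  by apply: qpath_cons Aq _; apply: qpath_nil.
exact: qpath_cons Ap (IH Aq).
Qed.

Definition word (w : bool) (l : seq (bool * bool)) : seq bool :=
  [seq a.2 | a <- l & a.1 == w].

Lemma word_cons w l w' b :
  word w ((w', b) :: l) = if w' == w then b :: word w l else word w l.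
Proof. by rewrite /word /=; case: ifP. Qed.

Lemma word_rcons w l w' b :
  word w (rcons l (w', b)) = if w' == w then rcons (word w l) b else word w l.
Proof. by rewrite /word filter_rcons /=; case: ifP; rewrite ?map_rcons. Qed.

Definition qdeterministic (A : seq queue_trans) : Prop := forall p w b q w' b' q',
  (p, w, b, q) \in A -> (p, w', b', q') \in A ->
  [/\ w = w', w -> b = b' & b = b' -> q = q'].

(* A path whose written and read words agree need not be causal, but
   determinism makes it agree with any queue computation: one of the two
   continues the other. *)
Lemma qpath_qsteps A p x g f l :
  qdeterministic A -> qsteps A (p, x) g ->
  qpath A p l f -> x ++ word true l = word false l ->
  (exists2 l', qpath A g.1 l' f & g.2 ++ word true l' = word false l') \/
  qsteps A (f, [::]) g.
Proof.
move=> detA /(clos_rt_rt1n _ _ _ _); move gE: (p, x) => g0 run.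
elim: run p x f l gE => {g0 g} [g|g0 g1 g st run IH] p x f l gE pl words.
  by left; exists l; rewrite -gE.
case: pl gE words => [q|q w b q' l' f' Aq pl'] gE.
  rewrite cats0 /word /= => x0; right; rewrite -x0 gE.
  exact: rt_trans (rt_step _ _ _ _ st) (clos_rt1n_rt _ _ _ _ run).
case: st gE run IH => q1 c q1' y Aq1 [qE xE] run IH; subst q1.
- have [wE bE q'E] := detA _ _ _ _ _ _ _ Aq1 Aq; subst w.
  rewrite !word_cons /= xE -cat_rcons -(bE isT) => words.
  by apply: IH pl' words; rewrite (q'E (bE isT)).
- have [wE _ q'E] := detA _ _ _ _ _ _ _ Aq1 Aq; subst w.
  rewrite !word_cons /= xE => -[cE words].
  by apply: IH pl' words; rewrite (q'E cE).
Qed.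

Lemma stuck_qsteps_no_qpath A p x p1 x1 f l :
  qdeterministic A -> qsteps A (p, x) (p1, x1) ->
  (forall w b q, (p1, w, b, q) \notin A) ->
  (forall w b q, (f, w, b, q) \in A -> q = f) -> p1 != f ->
  qpath A p l f -> x ++ word true l <> word false l.
Proof.
move=> detA run stuck absorb /eqP nf pl /(qpath_qsteps detA run pl)[[l' /= pl' _]|].
  inversion pl' as [|? ? ? ? ? ? Ap]; first by subst.
  by move: Ap; apply/negP/stuck.
by move/(qsteps_absorbing absorb).
Qed.

(** * Queue programs *)

Inductive instr := Enq of bool & nat | Deq of nat & nat | Stop.

Definition acts (i : instr) : seq (bool * bool * nat) :=
  match i with
  | Enq b q => [:: (true, b, q)]
  | Deq q0 q1 => [:: (false, false, q0); (false, true, q1)]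
  | Stop => [::]
  end.

Definition automaton (T : seq instr) : seq queue_trans :=
  flatten [seq [seq (p, a.1.1, a.1.2, a.2) | a <- acts (nth Stop T p)]
          | p <- iota 0 (size T)].

Lemma mem_automaton T p w b q :
  ((p, w, b, q) \in automaton T) = ((w, b, q) \in acts (nth Stop T p)).
Proof.
apply/flatten_mapP/idP => [[p0 _ /mapP[[[w0 b0] q0] a0 /= [-> -> -> ->]]]//|a].
exists p; last by apply/mapP; exists (w, b, q).
by rewrite mem_iota /= add0n ltnNge; apply: contraL a => le; rewrite nth_default.
Qed.

Lemma qdeterministic_automaton T : qdeterministic (automaton T).
Proof.
move=> p w b q w' b' q'; rewrite !mem_automaton.
case: (nth Stop T p) => [c x|x y|] //=; rewrite !inE.
  by move=> /eqP[-> -> ->] /eqP[-> -> ->].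
by move=> /orP[] /eqP[-> -> ->] /orP[] /eqP[-> -> ->].
Qed.

Definition has_code (A : seq queue_trans) (p : nat) (T : seq instr) : Prop :=
  forall i w b q, (w, b, q) \in acts (nth Stop T i) -> (p + i, w, b, q) \in A.

Lemma has_code_automaton T : has_code (automaton T) 0 T.
Proof. by move=> i w b q; rewrite mem_automaton. Qed.

Lemma has_code_cat A p T1 T2 :
  has_code A p (T1 ++ T2) -> has_code A p T1 /\ has_code A (p + size T1) T2.
Proof.
move=> coded; split=> i w b q acted; last first.
  by rewrite -addnA; apply: coded; rewrite nth_cat ltnNge leq_addr addKn.
by apply: coded; rewrite nth_cat; case: ltnP acted => // le; rewrite nth_default.
Qed.

Lemma has_code_cons A p i T :
  has_code A p (i :: T) ->
  (forall w b q, (w, b, q) \in acts i -> (p, w, b, q) \in A) /\ has_code A p.+1 T.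
Proof.
move=> coded; split=> [w b q /(coded 0)|j w b q /(coded j.+1)]; first by rewrite addn0.
by rewrite addSnnS.
Qed.

Lemma has_code_enq A p b q T :
  has_code A p (Enq b q :: T) -> (p, true, b, q) \in A /\ has_code A p.+1 T.
Proof. by case/has_code_cons=> acted hT; split=> //; apply: acted; rewrite inE. Qed.

Lemma has_code_deq A p q0 q1 T :
  has_code A p (Deq q0 q1 :: T) ->
  [/\ (p, false, false, q0) \in A, (p, false, true, q1) \in A & has_code A p.+1 T].
Proof.
by case/has_code_cons=> acted hT; split=> //; apply: acted; rewrite !inE eqxx ?orbT.
Qed.

Definition unary (n : nat) : seq bool := rcons (nseq n true) false.

Definition encode (c : seq nat) : seq bool := flatten [seq unary n | n <- c].

Lemma encode_cons n c : encode (n :: c) = nseq n true ++ false :: encode c.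
Proof. by rewrite /encode /= cat_rcons. Qed.

Lemma encode_rcons c n : encode (rcons c n) = encode c ++ unary n.
Proof. by rewrite /encode map_rcons flatten_rcons. Qed.

Fixpoint code_size (P : rprog) : nat :=
  match P with
  | Rot => 3
  | IncRot => 4
  | RSeq P Q => code_size P + code_size Q
  | RLoop P => (code_size P).+2
  end.

(* Code for [P], loaded at address [p] and leaving at address [q]. *)
Fixpoint code (P : rprog) (p q : nat) : seq instr :=
  match P with
  | Rot => [:: Deq p.+2 p.+1; Enq true p; Enq false q]
  | IncRot => [:: Deq p.+2 p.+1; Enq true p; Enq true p.+3; Enq false q]
  | RSeq P Q => code P p (p + code_size P) ++ code Q (p + code_size P) q
  | RLoop P => [:: Deq p.+1 p.+2, Enq false q & code P p.+2 p]
  end.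

Lemma size_code P p q : size (code P p q) = code_size P.
Proof. by elim: P p q => //= [P IHP Q IHQ|P IH] p q; rewrite ?size_cat ?IHP ?IHQ ?IH. Qed.

Lemma qsteps_move_ones A p q n x :
  (p, false, true, p.+1) \in A -> (p.+1, true, true, p) \in A ->
  (p, false, false, q) \in A ->
  qsteps A (p, nseq n true ++ false :: x) (q, x ++ nseq n true).
Proof.
move=> A1 A2 A3; elim: n x => [|n IH] x /=; first by rewrite cats0; apply: qsteps_read.
apply: rt_trans (qsteps_read _ A1) _; apply: rt_trans (qsteps_write A2 (erefl _)) _.
by have := IH (rcons x true); rewrite rcons_cat cat_rcons.
Qed.

Lemma qsteps_code A P p q c c' :
  rexec P c c' -> has_code A p (code P p q) -> qsteps A (p, encode c) (q, encode c').
Proof.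
move=> xP; elim: P c c' / xP p q =>
  [n c|n c|P Q c c1 c2 _ IH1 _ IH2|P c|P n c c1 c2 _ IH1 _ IH2] p q.
- case/has_code_deq=> read0 read1 /has_code_enq[write1 /has_code_enq[write0 _]].
  rewrite encode_rcons encode_cons.
  apply: rt_trans (qsteps_move_ones _ _ read1 write1 read0) _.
  by apply: qsteps_write write0 _; rewrite rcons_cat.
- case/has_code_deq=> read0 read1 /has_code_enq[write1].
  case/has_code_enq=> write_inc /has_code_enq[write0 _].
  rewrite encode_rcons encode_cons.
  apply: rt_trans (qsteps_move_ones _ _ read1 write1 read0) _.
  apply: rt_trans (qsteps_write write_inc (erefl _)) _; apply: qsteps_write write0 _.
  by rewrite !rcons_cat -(cats1 (nseq n true)) -(nseqD n 1) addn1.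
- rewrite /= => /has_code_cat[codeP]; rewrite size_code => codeQ.
  exact: rt_trans (IH1 _ _ codeP) (IH2 _ _ codeQ).
- case/has_code_deq=> read0 _ /has_code_enq[write0 _]; rewrite encode_rcons.
  apply: rt_trans (qsteps_read _ read0) _.
  by apply: qsteps_write write0 _; rewrite cats1.
- move=> codeL; have [_ read1 /has_code_enq[_ codeP]] := has_code_deq codeL.
  apply: rt_trans (qsteps_read _ read1) _.
  exact: rt_trans (IH1 _ _ codeP) (IH2 _ _ codeL).
Qed.

Lemma qsteps_pad A p n c :
  has_code A p [seq Enq false i.+1 | i <- iota p n] ->
  qsteps A (p, encode c) (p + n, encode (c ++ nseq n 0)).
Proof.
elim: n p c => [|n IH] p c /=; first by rewrite addn0 cats0 => _; apply: rt_refl.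
case/has_code_enq=> write0 /IH pad; rewrite addnS -cat_rcons -addSn.
by apply: rt_trans (qsteps_write write0 _) (pad _); rewrite encode_rcons cats1.
Qed.

Lemma qsteps_drain A p x :
  (forall b, (p, false, b, p) \in A) -> qsteps A (p, x) (p, [::]).
Proof.
move=> drain; elim: x => [|b x IH]; first exact: rt_refl.
exact: rt_trans (qsteps_read _ (drain b)) IH.
Qed.

(* State 0 accepts, state 1 rejects, and state 2 is the entry point. *)
Definition zero_test (f : recf) (A : seq queue_trans) : Prop :=
  [/\ qdeterministic A,
      forall w b q, (0, w, b, q) \in A -> q = 0,
      forall w b q, (1, w, b, q) \notin A &
      forall x y, reval f [:: x] y ->
        if y == 0 then qsteps A (2, unary x) (0, [::])
        else exists z, qsteps A (2, unary x) (1, z)].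

Definition zero_test_program (f : recf) : seq instr :=
  let n := workspace f in
  let p := 2 + n in
  let q := p + code_size (rotating_recf f) in
  [:: Deq 0 0; Stop] ++ [seq Enq false i.+1 | i <- iota 2 n]
  ++ code (rotating_recf f) p q ++ [:: Deq 0 1].

Lemma zero_test_automaton f : zero_test f (automaton (zero_test_program f)).
Proof.
split; first exact: qdeterministic_automaton.
- by move=> w b q; rewrite mem_automaton !inE => /orP[] /eqP[].
- by move=> w b q; rewrite mem_automaton.
move=> x y /rexec_rotating_recf[c xP].
have /has_code_cat[/has_code_deq[acc0 acc1 _]] :=
  @has_code_automaton (zero_test_program f).
case/has_code_cat=> pad /has_code_cat[]; rewrite size_map size_iota size_code.
move=> run /has_code_deq[read0 read1 _].
have {pad run} := rt_trans _ _ _ _ _ (qsteps_pad [:: x] pad) (qsteps_code xP run).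
rewrite /encode /= cats0 -/(encode _).
case: y {xP} => [|y] /= run.
  apply: rt_trans run (rt_trans _ _ _ _ _ (qsteps_read _ read0) (qsteps_drain _ _)).
  by case.
by eexists; apply: rt_trans run (qsteps_read _ read1).
Qed.

(** * Simulating a queue on a cycle *)

Definition undirected_cycle (N E : finType) (tl hd : E -> N) (k : nat)
    (e : 'I_k.+1 -> E) (v : 'I_k.+1 -> N) : Prop :=
  injective e /\ injective v /\
  forall i, (tl (e i) = v i /\ hd (e i) = v (ordS i)) \/
            (hd (e i) = v i /\ tl (e i) = v (ordS i)).

Definition forward (N E : finType) (tl hd : E -> N) (k : nat)
    (e : 'I_k.+1 -> E) (v : 'I_k.+1 -> N) (i : 'I_k.+1) : bool :=
  (tl (e i) == v i) && (hd (e i) == v (ordS i)).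

Lemma ordS_rev_ordS k (i : 'I_k.+1) : ordS (rev_ord (ordS i)) = rev_ord i.
Proof.
apply: val_inj; rewrite /= !subSS.
have [->|lti] : i = k :> nat \/ i < k by have := ltn_ord i; lia.
  by rewrite modnn subn0 subnn modnn.
by rewrite (modn_small (_ : i.+1 < k.+1)) // subnSK // modn_small // ltnS leq_subr.
Qed.

Lemma ord_pred_zero k (i : 'I_k.+1) : i = 0 :> nat -> ord_pred i = ord_max.
Proof. by move=> i0; apply: val_inj; rewrite /= i0 modn_small. Qed.

Lemma ord_pred_lt k (i : 'I_k.+1) : 0 < i -> ord_pred i < i.
Proof.
move=> i_gt0; rewrite /= -[in X in X %% _](prednK i_gt0) /= modnDr.
by rewrite modn_small ?ltn_predL // prednK // ltnW.
Qed.

Lemma ord_pred_neq_max k (i : 'I_k.+1) : 0 < i -> ord_pred i != ord_max.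
Proof.
by move=> /ord_pred_lt ltpi; rewrite -val_eqE ltn_eqF // (leq_trans ltpi) // -ltnS.
Qed.

(* Reversing the vertices fixes the closing edge, from the last vertex to the
   first one, and exchanges its two orientations. *)
Lemma has_cycle_closed_forward (N E : finType) (tl hd : E -> N) :
  undirected_has_cycle tl hd -> exists k (e : 'I_k.+1 -> E) (v : 'I_k.+1 -> N),
    undirected_cycle tl hd e v /\ forward tl hd e v ord_max.
Proof.
case=> k [e [v [e_inj [v_inj ends]]]]; exists k.
have [fw|/negP nfw] := boolP (forward tl hd e v ord_max); first by exists e, v.
exists (fun i => e (rev_ord (ordS i))), (fun i => v (rev_ord i)); split.
  split=> [i j /e_inj /rev_ord_inj /ordS_inj //|].
  split=> [i j /v_inj /rev_ord_inj //|i].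
  by case: (ends (rev_ord (ordS i))); rewrite ordS_rev_ordS => -[-> ->]; [right | left].
have max_fixed : rev_ord (ordS ord_max) = ord_max :> 'I_k.+1.
  by apply: val_inj; rewrite /= modnn subn1.
rewrite /forward max_fixed; have := ordS_rev_ordS (@ord_max k); rewrite max_fixed => <-.
case: (ends ord_max) => -[fstE sndE]; last by rewrite fstE sndE !eqxx.
by case: nfw; rewrite /forward fstE sndE !eqxx.
Qed.

Definition ffset (T : finType) (X : Type) (f : {ffun T -> X}) (a : T) (x : X) :
  {ffun T -> X} := [ffun b => if b == a then x else f b].

Section FfunUpdate.
Variables (T : finType) (X : Type).
Implicit Types (f : {ffun T -> X}) (a b : T) (x y : X).

Lemma ffset_same f a x : ffset f a x a = x. Proof. by rewrite ffunE eqxx. Qed.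

Lemma ffset_other f a x b : b != a -> ffset f a x b = f b.
Proof. by move=> /negPf nba; rewrite ffunE nba. Qed.

Lemma ffset_id f a x : f a = x -> ffset f a x = f.
Proof. by move=> fa; apply/ffunP => b; rewrite ffunE; case: eqP => // ->. Qed.

Lemma ffset_ffset f a x y : ffset (ffset f a x) a y = ffset f a y.
Proof. by apply/ffunP => b; rewrite !ffunE; case: eqP. Qed.

Lemma ffsetC f a b x y : a != b -> ffset (ffset f a x) b y = ffset (ffset f b y) a x.
Proof.
move=> nab; apply/ffunP => c; rewrite !ffunE; case: eqP => // ->.
by rewrite eq_sym (negPf nab).
Qed.

End FfunUpdate.

Section Ring.
Variables (N E : finType) (tl hd : E -> N) (k : nat).
Variables (e : 'I_k.+1 -> E) (v : 'I_k.+1 -> N).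
Implicit Types (i j : 'I_k.+1) (St : composite_state N) (C : channels E).

Let fw := forward tl hd e v.

Definition message (xi : E) (b : bool) : nat := (enum_rank xi).*2 + b.

(* Node [i] writes on edge [e i] and reads on edge [e (ord_pred i)]; whether
   that is a send or a receive depends on the orientation of the edge. *)
Definition side i (w : bool) : E := e (if w then i else ord_pred i).

Definition sends i (w : bool) : bool := if w then fw i else ~~ fw (ord_pred i).

Definition globalize i (t : queue_trans) : nat * bool * nat * nat :=
  let: (p, w, b, q) := t in (p, sends i w, message (side i w) b, q).

(* A relay reads before it writes if its outgoing edge is forward, and writes
   before it reads otherwise; state [b.+1] remembers the letter [b] in between. *)
Definition relay i : seq queue_trans :=
  flatten [seq [:: (0, ~~ fw i, b, (nat_of_bool b).+1);
                   ((nat_of_bool b).+1, fw i, b, 0)] | b : bool <- [:: false; true]].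

Section RingProtocol.
Variables (A : seq queue_trans) (bound start : nat).

Definition local i : seq queue_trans := if i == ord_max then A else relay i.

Definition ring_trans (x : N) : seq (nat * bool * nat * nat) :=
  if [pick i | v i == x] is Some i then [seq globalize i t | t <- local i] else [::].

Definition ring : protocol N E :=
  ([ffun xi => [:: message xi false; message xi true]],
   [ffun x => if x == v ord_max then bound else 3],
   [ffun x => if x == v ord_max then start else 0],
   [ffun x => ring_trans x]).

Definition controller_at (p : nat) : composite_state N :=
  [ffun x => if x == v ord_max then p else 0].

Lemma message_inj xi b zeta c : message xi b = message zeta c -> xi = zeta /\ b = c.
Proof.
rewrite /message => mE; have rE : enum_rank xi = enum_rank zeta.
  by apply: val_inj => /=; case: b c mE => -[] /=; lia.
by split; [apply: enum_rank_inj | case: b c mE => -[] //; rewrite rE; lia].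
Qed.

Lemma mem_msgs_ring xi b :
  (b \in msgs ring xi) = (b == message xi false) || (b == message xi true).
Proof. by rewrite /msgs /= ffunE !inE. Qed.

Lemma mem_message xi b : message xi b \in msgs ring xi.
Proof. by rewrite mem_msgs_ring; case: b; rewrite eqxx ?orbT. Qed.

Lemma message_msgs_inj xi zeta b : message xi b \in msgs ring zeta -> xi = zeta.
Proof. by rewrite mem_msgs_ring => /orP[] /eqP /message_inj[]. Qed.

Lemma ring_transP x p sn m q : (p, sn, m, q) \in ring_trans x ->
  exists i w b, [/\ x = v i, (p, w, b, q) \in local i,
                    sn = sends i w & m = message (side i w) b].
Proof.
rewrite /ring_trans; case: pickP => // i /eqP <- /mapP[[[[p' w] b] q'] t [-> -> -> ->]].
by exists i, w, b.
Qed.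

Hypothesis cyc : undirected_cycle tl hd e v.

Let e_inj : injective e. Proof. by case: cyc. Qed.
Let v_inj : injective v. Proof. by case: cyc => _ []. Qed.

Lemma forward_endpoints i :
  if fw i then tl (e i) = v i /\ hd (e i) = v (ordS i)
  else hd (e i) = v i /\ tl (e i) = v (ordS i).
Proof.
rewrite /fw /forward; case: cyc => _ [_ /(_ i) ends].
case: andP => [[/eqP-> /eqP->]|nfw] //=; case: ends => [[tlE hdE]|//].
by case: nfw; rewrite tlE hdE !eqxx.
Qed.

Lemma sends_endpoint i w :
  if sends i w then tl (side i w) = v i else hd (side i w) = v i.
Proof.
rewrite /sends /side; case: w; first by have := forward_endpoints i; case: ifP => _ [].
by have := forward_endpoints (ord_pred i); rewrite ord_predK; case: ifP => _ [].
Qed.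

Lemma mem_ring_trans i p w b q :
  (p, w, b, q) \in local i -> globalize i (p, w, b, q) \in trans ring (v i).
Proof.
move=> t; rewrite /trans /= ffunE /ring_trans.
case: pickP => [j /eqP /v_inj ->|/(_ i)]; last by rewrite eqxx.
exact: (map_f (globalize i) t).
Qed.

Lemma wf_ring : start < bound ->
  (forall p w b q, (p, w, b, q) \in A -> p < bound /\ q < bound) ->
  wf_protocol tl hd ring.
Proof.
move=> lt_start ltA; split; last split.
- move=> xi zeta nxz m; rewrite mem_msgs_ring => /orP[] /eqP->;
    by apply: contra nxz => /message_msgs_inj ->.
- by move=> x; rewrite /init /nstates /= !ffunE; case: ifP.
- move=> x p sn m q; rewrite /trans /= ffunE => /ring_transP[i [w [b [-> t -> ->]]]].
  have [ltp ltq] : p < nstates ring (v i) /\ q < nstates ring (v i).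
    rewrite /nstates /= ffunE inj_eq //; move: t; rewrite /local.
    by case: eqP => _; [apply: ltA | rewrite !inE => /or4P[] /eqP[-> _ _ ->]].
  split=> //; exists (side i w); split; [exact: mem_message | exact: sends_endpoint].
Qed.

Lemma ring_step St C C' i p w b q y :
  (p, w, b, q) \in local i -> St (v i) = p ->
  (if sends i w then y = rcons (C (side i w)) (message (side i w) b)
   else C (side i w) = message (side i w) b :: y) ->
  C' = ffset C (side i w) y ->
  step tl hd ring (St, C) (ffset St (v i) q, C').
Proof.
move=> t Si Cy ->; exists (v i), p, (sends i w), (message (side i w) b), q, (side i w).
split; [exact: mem_ring_trans | by rewrite ffset_same | | exact: mem_message | ].
- by move=> x; apply: ffset_other.
- split=> [z|]; first exact: ffset_other.
  by have := sends_endpoint i w; rewrite ffset_same; case: sends Cy.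
Qed.

Notation steps := (clos_refl_trans _ (step tl hd ring)).

(* Whichever of the writer and the reader sends on the edge goes first. *)
Lemma rendezvous St C i p b p' q q' :
  ord_pred i != i -> C (e (ord_pred i)) = [::] ->
  (p, true, b, p') \in local (ord_pred i) -> St (v (ord_pred i)) = p ->
  (q, false, b, q') \in local i -> St (v i) = q ->
  steps (St, C) (ffset (ffset St (v (ord_pred i)) p') (v i) q', C).
Proof.
set j := ord_pred i => nji Cj writes_b Sj reads_b Si.
have nv : v j != v i by rewrite inj_eq.
pose Cfull := ffset C (e j) [:: message (e j) b].
have Cfull_j : Cfull (e j) = [:: message (e j) b] by rewrite ffset_same.
have CE : C = ffset Cfull (e j) [::] by rewrite ffset_ffset ffset_id.
have [fwj|bwj] := boolP (fw j).
- apply: (@rt_trans _ _ _ (ffset St (v j) p', Cfull)); apply: rt_step.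
    by apply: ring_step writes_b Sj _ (erefl _); rewrite /sends fwj /side Cj.
  apply: ring_step reads_b _ _ CE; first by rewrite ffset_other // eq_sym.
  by rewrite /sends /side -/j fwj Cfull_j.
- rewrite ffsetC //; apply: (@rt_trans _ _ _ (ffset St (v i) q', Cfull)); apply: rt_step.
    by apply: ring_step reads_b Si _ (erefl _); rewrite /sends /side -/j bwj Cj.
  apply: ring_step writes_b _ _ CE; first by rewrite ffset_other.
  by rewrite /sends /side (negPf bwj) Cfull_j.
Qed.

Lemma mem_relay i b :
  (0, ~~ fw i, b, (nat_of_bool b).+1) \in relay i /\
  ((nat_of_bool b).+1, fw i, b, 0) \in relay i.
Proof. by case: b; rewrite !inE !eqxx ?orbT. Qed.

Hypothesis fw_max : fw ord_max.

Definition queue (x : seq bool) : channels E :=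
  [ffun xi => if xi == e ord_max then [seq message xi b | b <- x] else [::]].

Lemma steps_read i St p b q x :
  (p, false, b, q) \in local i -> St (v i) = p ->
  (forall j, j < i -> St (v j) = 0) ->
  steps (St, queue (b :: x)) (ffset St (v i) q, queue x).
Proof.
have [m] := ubnP (i : nat); elim: m => // m IH in i St p b q x * => ltim t Si idle.
have [i0|i_gt0] := posnP i.
  have predi := ord_pred_zero i0.
  apply: rt_step; apply: ring_step t Si _ _.
    by rewrite /sends predi fw_max /side predi !ffunE eqxx.
  by apply/ffunP => z; rewrite /side predi !ffunE; case: eqP => // ->.
have := ord_pred_neq_max i_gt0; have := ord_pred_lt i_gt0.
set j := ord_pred i => ltji nj_max.
have nji : j != i by rewrite -val_eqE ltn_eqF.
have Cj y : queue y (e j) = [::] by rewrite ffunE inj_eq // (negPf nj_max).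
have Sj : St (v j) = 0 by apply: idle.
have [first_half second_half] := mem_relay j b.
have localj : local j = relay j by rewrite /local (negPf nj_max).
case fwj: (fw j) first_half second_half; rewrite -localj => first_half second_half.
- apply: rt_trans (IH j St 0 b b.+1 x _ first_half Sj _) _.
  + exact: leq_trans ltji ltim.
  + by move=> l ltlj; apply: idle (ltn_trans ltlj ltji).
  have <- : ffset (ffset (ffset St (v j) b.+1) (v j) 0) (v i) q = ffset St (v i) q.
    by rewrite ffset_ffset (ffset_id Sj).
  apply: rendezvous second_half _ t _ => //; first by rewrite ffset_same.
  by rewrite ffset_other // inj_eq // eq_sym.
- apply: rt_trans (rendezvous nji (Cj _) first_half Sj t Si) _.
  set St' := ffset _ _ _; have <- : ffset St' (v j) 0 = ffset St (v i) q.
    by rewrite ffsetC ?inj_eq // 1?eq_sym // ffset_ffset (ffset_id Sj).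
  apply: IH second_half _ _; first exact: leq_trans ltji ltim.
    by rewrite ffset_other ?inj_eq // ffset_same.
  move=> l ltlj; have ltli := ltn_trans ltlj ltji.
  by rewrite !ffset_other ?inj_eq ?idle // -val_eqE ltn_eqF.
Qed.

Lemma ffset_controller p q :
  ffset (controller_at p) (v ord_max) q = controller_at q.
Proof. by apply/ffunP => x; rewrite !ffunE; case: eqP. Qed.

Lemma steps_qsteps g h : qsteps A g h ->
  steps (controller_at g.1, queue g.2) (controller_at h.1, queue h.2).
Proof.
have localA : local ord_max = A by rewrite /local eqxx.
elim=> {g h} [g h st|g|g1 g2 g3 _ IH1 _ IH2]; [|exact: rt_refl|exact: rt_trans IH1 IH2].
case: st => p b q x; rewrite -localA => t /=; rewrite -(ffset_controller p q).
  apply: rt_step; apply: ring_step t _ _ _; first by rewrite ffunE eqxx.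
    by rewrite /sends fw_max.
  by apply/ffunP => z; rewrite !ffunE /side eqxx map_rcons; case: eqP => // ->.
apply: steps_read t _ _; first by rewrite ffunE eqxx.
by move=> j ltj; rewrite ffunE inj_eq // -val_eqE ltn_eqF.
Qed.

Lemma queue_nil : queue [::] = empty_channels E.
Proof. by apply/ffunP => xi; rewrite !ffunE if_same. Qed.

Lemma stable_of_qsteps p :
  qsteps A (start, [::]) (p, [::]) -> stable tl hd ring (controller_at p).
Proof.
move=> /steps_qsteps /=; rewrite queue_nil /stable /initial_global.
by congr (steps (_, _)); apply/ffunP => x; rewrite /init /= !ffunE.
Qed.

(* [l i] is the history of node [i]; what has been sent on an edge is what has
   been received followed by the content of the channel. *)
Definition coherent (g : composite_state N * channels E)
    (l : 'I_k.+1 -> seq (bool * bool)) : Prop :=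
  (forall i, qpath (local i) (if i == ord_max then start else 0) (l i) (g.1 (v i))) /\
  (forall i,
     let written := [seq message (e i) b | b <- word true (l i)] in
     let read := [seq message (e i) b | b <- word false (l (ordS i))] in
     if fw i then written = read ++ g.2 (e i) else read = written ++ g.2 (e i)).

Lemma coherent_initial : coherent (initial_global ring) (fun=> [::]).
Proof.
split=> i; last by rewrite /= ffunE; case: ifP.
by rewrite /= ffunE /init /= ffunE inj_eq //; apply: qpath_nil.
Qed.

Lemma coherent_step g h l :
  step tl hd ring g h -> coherent g l -> exists l', coherent h l'.
Proof.
case: g h => [St C] [St' C'] [x [p [sn [m [q [xi [t [Sp Sq] St'E mxi [C'E Cxi]]]]]]]].
case=> /= paths chans; rewrite /trans /= ffunE in t.
have [i [w [b [xE {}t snE mE]]]] := ring_transP t; subst x sn m.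
have xiE := message_msgs_inj mxi; subst xi.
exists (fun j => if j == i then rcons (l i) (w, b) else l j); split=> j /=.
  have [->|nji] := eqVneq j i; last by rewrite St'E ?inj_eq.
  by rewrite Sq; apply: qpath_rcons t; rewrite -Sp.
have wordE w' j' : word w' (if j' == i then rcons (l i) (w, b) else l j') =
    if (j' == i) && (w == w') then rcons (word w' (l j')) b else word w' (l j').
  by case: eqP => // ->; rewrite word_rcons.
rewrite !wordE {wordE}; have := chans j; case: w t mxi C'E Cxi => t mxi.
- rewrite /side /sends /= andbT andbF => C'E; have [-> {j}|nji] := eqVneq j i.
    by case: (fw i) => -[_ ->]; rewrite map_rcons => ->; rewrite ?rcons_cat ?cat_rcons.
  by rewrite (C'E (e j)) ?inj_eq.
- rewrite /side /sends /= andbT andbF (can2_eq (@ordSK _) (@ord_predK _)) => C'E.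
  have [-> {j}|nji] := eqVneq j (ord_pred i).
    rewrite ord_predK; case: (fw _) => -[_ ->]; rewrite map_rcons => ->;
      by rewrite ?rcons_cat ?cat_rcons.
  by rewrite (C'E (e j)) ?inj_eq.
Qed.

Lemma relay_words i l : qpath (relay i) 0 l 0 -> word true l = word false l.
Proof.
pose pending p := if p is p'.+1 then [:: p' == 1] else [::].
suff relayed p q : qpath (relay i) p l q -> q = 0 ->
    word (fw i) l = pending p ++ word (~~ fw i) l.
  by move=> /relayed/(_ (erefl _)) /=; case: (fw i).
elim=> {p l q} [p -> //|p w b q l f t _ IH /IH {IH}].
by move: t; rewrite !inE !word_cons => /or4P[] /eqP[-> -> -> ->] /=; case: (fw i) => /= ->.
Qed.

Lemma coherent_words p l : coherent (controller_at p, empty_channels E) l ->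
  word true (l ord_max) = word false (l ord_max).
Proof.
case=> paths chans; suff all_eq i : word false (l i) = word true (l ord_max) by [].
have edge j : word true (l j) = word false (l (ordS j)).
  have inj_msg : injective (message (e j)) by move=> b c /message_inj[].
  by have := chans j; rewrite /= ffunE !cats0; case: (fw j) => /(inj_map inj_msg).
have [m] := ubnP (i : nat); elim: m => // m IH in i * => ltim; rewrite -{1}(ord_predK i).
rewrite -edge; have [/ord_pred_zero -> //|i_gt0] := posnP i.
rewrite -(IH (ord_pred i) (leq_trans (ord_pred_lt i_gt0) ltim)).
apply: (@relay_words (ord_pred i)); have := paths (ord_pred i).
by rewrite /local ffunE inj_eq // (negPf (ord_pred_neq_max i_gt0)).
Qed.

Lemma qpath_of_stable p : stable tl hd ring (controller_at p) ->
  exists2 l, qpath A start l p & word true l = word false l.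
Proof.
move=> run; have [l coh] : exists l, coherent (controller_at p, empty_channels E) l.
  have: exists l, coherent (initial_global ring) l.
    by exists (fun=> [::]); apply: coherent_initial.
  elim: run => // [g h st [l]|g1 g2 g3 _ IH1 _ IH2 /IH1 /IH2 //]; exact: coherent_step.
exists (l ord_max); last exact: coherent_words coh.
by case: coh => /(_ ord_max) + _; rewrite /= /local !eqxx ffunE eqxx.
Qed.

End RingProtocol.
End Ring.

(** * Self-application *)

(* From state [a + n], write [n] in unary and enter [A] in state 2. *)
Fixpoint load (a n : nat) (A : seq queue_trans) : seq queue_trans :=
  if n is n'.+1 then (a + n, true, true, a + n') :: load a n' A
  else (a, true, false, 2) :: A.

Lemma subset_load a n A : {subset A <= load a n A}.
Proof. by elim: n => [|n IH] t tA; rewrite inE ?tA ?IH ?orbT. Qed.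

Lemma mem_load a n A p w b q : (p, w, b, q) \in load a n A ->
  (p, w, b, q) \in A \/
  a <= p <= a + n /\ (w, b, q) = if p == a then (true, false, 2) else (true, true, p.-1).
Proof.
elim: n => [|n IH] /=; rewrite inE => /predU1P[[-> -> -> ->]|].
- by right; rewrite eqxx leqnn leq_addr.
- by left.
- by right; rewrite leq_addr leqnn -[X in _ == X]addn0 eqn_add2l addnS.
- by case/IH=> [|[/andP[lea len] ->]]; [left | right; rewrite lea addnS leqW].
Qed.

Lemma qsteps_load a n A B x : {subset load a n A <= B} ->
  qsteps B (a + n, x) (2, rcons (x ++ nseq n true) false).
Proof.
elim: n x => [|n IH] x sub.
  by rewrite addn0 cats0; apply: qsteps_write (sub _ (mem_head _ _)) _.
apply: rt_trans (qsteps_write (sub _ (mem_head _ _)) (erefl _)) _.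
by rewrite -cat_rcons; apply: IH => t t_load; apply: sub; rewrite inE t_load orbT.
Qed.

Lemma qdeterministic_load a n A :
  (forall p w b q, (p, w, b, q) \in A -> p < a) ->
  qdeterministic A -> qdeterministic (load a n A).
Proof.
move=> ltA detA p w b q w' b' q' /mem_load[t|[/andP[lea _] tE]] /mem_load[t'|[lea' tE']].
- exact: detA t t'.
- by have := ltA _ _ _ _ t; case/andP: lea'; lia.
- by have := ltA _ _ _ _ t'; lia.
- by move: tE'; rewrite -tE => -[-> -> ->].
Qed.

Section SelfApplication.
Variables (N E : finType) (tl hd : E -> N) (k : nat).
Variables (e : 'I_k.+1 -> E) (v : 'I_k.+1 -> N).

Definition controller_trans (A : seq queue_trans) : seq (nat * bool * nat * nat) :=
  [seq globalize tl hd e v ord_max t | t <- A].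

Definition controller_code (A : seq queue_trans) : nat := pickle (controller_trans A).

Definition self_loading (A : seq queue_trans) : seq queue_trans :=
  load (controller_code A).+2 (controller_code A) A.

Definition loading_state (A : seq queue_trans) : nat :=
  (controller_code A).+2 + controller_code A.

Definition self_applied (A : seq queue_trans) : scs_input N E :=
  (ring tl hd e v (self_loading A) (loading_state A).+1 (loading_state A),
   controller_at v 0).

Lemma state_lt_controller_code A p w b q :
  (p, w, b, q) \in A -> p < controller_code A /\ q < controller_code A.
Proof.
move=> /(map_f (globalize tl hd e v ord_max)) /ltn_pickle_mem.
rewrite -/(controller_code A) /=; set sn := sends _ _ _ _ _ _; set m := message _ _.
have [lt_psm lt_q] := ltn_pickle_pair (p, sn, m) q.
have [lt_ps _] := ltn_pickle_pair (p, sn) m; have [lt_p _] := ltn_pickle_pair p sn.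
move=> lt_code; split; last exact: ltn_trans lt_q lt_code.
exact: ltn_trans lt_p (ltn_trans lt_ps (ltn_trans lt_psm lt_code)).
Qed.

Lemma self_applied_valid A :
  undirected_cycle tl hd e v -> scs_valid tl hd (self_applied A).
Proof.
move=> cyc; split; last by move=> x; rewrite /nstates /= !ffunE; case: ifP.
apply: (wf_ring cyc) => // p w b q /mem_load[/state_lt_controller_code|[]].
  by rewrite /loading_state; lia.
by rewrite /loading_state; case: eqP => _ + [_ _ ->]; lia.
Qed.

Lemma computable_transition (A : Type) n (input : A -> n.-tuple nat) (F G : A -> nat)
    (sn : bool) (m : nat) :
  computable input F -> computable input G ->
  computable input (fun a => (F a, sn, m, G a)).
Proof.
move=> cF cG; apply: computable_pair cG.
by do 2![apply: computable_pair; last exact: computable_const].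
Qed.

Lemma controller_trans_load a n A :
  controller_trans (load a n A) = nat_rect (fun=> seq (nat * bool * nat * nat))
    (globalize tl hd e v ord_max (a, true, false, 2) :: controller_trans A)
    (fun m ts => globalize tl hd e v ord_max (a + m.+1, true, true, a + m) :: ts) n.
Proof. by elim: n => //= n <-. Qed.

Let input (A : seq queue_trans) : 1.-tuple nat := [tuple controller_code A].

Let computable_code : computable input controller_code := computable_nth input 0.

Lemma computable_self_loading :
  computable input (fun A => controller_trans (self_loading A)).
Proof.
apply: eq_computable (fun A => esym (controller_trans_load _ _ A)) _.
have code_rec := computable_rec_input (seq (nat * bool * nat * nat)) computable_code.
have index := computable_nth (@rec_input _ _ input (seq (nat * bool * nat * nat))) 0.
apply: (computable_rec (G := fun m ts A => globalize tl hd e v ord_max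
  ((controller_code A).+2 + m.+1, true, true, (controller_code A).+2 + m) :: ts)) => //.
- apply: computable_cons; last by exists (RProj 0) => A; apply: ev_proj.
  by apply: computable_transition; [do 2!apply: computable_succ | apply: computable_const].
- apply: computable_cons; last by exists (RProj 1) => -[[n ts] A]; apply: ev_proj.
  by apply: computable_transition; apply: computable_add; do ?apply: computable_succ.
Qed.

Lemma computable_self_applied : computable input self_applied.
Proof.
have state : computable input loading_state.
  by apply: computable_add => //; do 2!apply: computable_succ.
have pick_node (b : bool) (F G : seq queue_trans -> nat) : computable input F ->
  computable input G -> computable input (fun A => if b then F A else G A) by case: b.
apply: computable_pair (computable_const _ _); apply: computable_pair.
  apply: computable_pair; first apply: computable_pair (computable_const _ _) _.
  - apply: computable_ffun => x; apply: pick_node (computable_const _ _).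
    exact: computable_succ.
  - by apply: computable_ffun => x; apply: pick_node (computable_const _ _).
apply: computable_ffun => x; rewrite /ring_trans /local.
case: pickP => [i _|_]; last exact: computable_const.
case: eqP => [->|_]; [exact: computable_self_loading | exact: computable_const].
Qed.

Section Decision.
Variables (f : recf) (A : seq queue_trans).
Hypotheses (cyc : undirected_cycle tl hd e v) (fw_max : forward tl hd e v ord_max).
Hypothesis test : zero_test f A.

Lemma qsteps_self_loading :
  qsteps (self_loading A) (loading_state A, [::]) (2, unary (controller_code A)).
Proof. exact: (@qsteps_load _ _ A _ [::]). Qed.

Lemma self_applied_stable :
  reval f [:: controller_code A] 0 -> scs_stable tl hd (self_applied A).
Proof.
case: test => _ _ _ run /run /= accept; apply: (stable_of_qsteps _ cyc fw_max).
exact: rt_trans qsteps_self_loading (qsteps_subset (@subset_load _ _ A) accept).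
Qed.

Lemma self_applied_not_stable n :
  reval f [:: controller_code A] n.+1 -> ~ scs_stable tl hd (self_applied A).
Proof.
case: test => detA absorb stuck run /run /= [x reject].
move=> /(qpath_of_stable cyc)[l pl words].
have low p w b q : p < (controller_code A).+2 ->
    (p, w, b, q) \in self_loading A -> (p, w, b, q) \in A.
  by move=> ltp /mem_load[|[/andP[]]] //; rewrite leqNgt ltp.
have rejected := rt_trans _ _ _ _ _ qsteps_self_loading
  (qsteps_subset (@subset_load _ _ A) reject).
apply: stuck_qsteps_no_qpath rejected _ _ _ pl words => //.
- apply: qdeterministic_load detA => p w b q /state_lt_controller_code[ltp _].
  exact: leqW (leqW ltp).
- by move=> w b q; apply/negP => /low t; have := stuck w b q; rewrite t.
- by move=> w b q /low t; apply: absorb (t _).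
Qed.

End Decision.
End SelfApplication.

Theorem theorem7p2 (N E : finType) (tl hd : E -> N) :
  undirected_has_cycle tl hd ->
  ~ decidable_on (@scs_valid N E tl hd) (@scs_stable N E tl hd).
Proof.
move=> /has_cycle_closed_forward[k [e [v [cyc fw_max]]]] [f decides].
have [d dP] := computable_self_applied tl hd e v.
set h := RComp f [:: d]; pose A := automaton (zero_test_program h).
have test : zero_test h A := zero_test_automaton h.
have run y : reval f [:: pickle (self_applied tl hd e v A)] y ->
    reval h [:: controller_code tl hd e v A] y.
  by apply: ev_comp; constructor; [apply: dP | constructor].
have [yes no] := decides _ (self_applied_valid A cyc).
have not_stable : ~ scs_stable tl hd (self_applied tl hd e v A).
  by move=> stable; apply: (self_applied_not_stable cyc test (run _ (yes stable))).
exact/not_stable/(self_applied_stable cyc fw_max test)/run/no.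
Qed.
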